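(* The function $f_{app}:\mathbb Z_+^{nL}\to\mathbb R$ defined in the context is DR-submodular. That is, for any integer vectors $\boldsymbol c\ge\boldsymbol b\ge\boldsymbol 0$ (componentwise) in $\mathbb Z_+^{nL}$ and any unit vector $\boldsymbol e_i^\ell$ ($i\in\mathcal N$, $\ell\in\mathcal L$), $$f_{app}(\boldsymbol c)+f_{app}(\boldsymbol b+\boldsymbol e_i^\ell)\ \ge\ f_{app}(\boldsymbol c+\boldsymbol e_i^\ell)+f_{app}(\boldsymbol b).$$
   Context: Let $\mathcal N=\{1,\dots,n\}$, $\mathcal M=\{1,\dots,m\}$, $\mathcal L=\{1,\dots,L\}$, $\mathcal L_+=\mathcal L\cup\{L+1\}$. Data: $r_{ij}^\ell\in\mathbb R$ for $i\in\mathcal N,j\in\mathcal M,\ell\in\mathcal L$, with $r_{ij}^{L+1}=0$; $\tau_j\ge0$; $v_{ij}\ge0$. Vectors $\boldsymbol c=(c_i^\ell)_{i\in\mathcal N,\ell\in\mathcal L}$; $\boldsymbol e_i^\ell$ is the unit vector of coordinate $(i,\ell)$. $f_{app}(\boldsymbol c)$ is the optimal value of the linear program over $\boldsymbol y=(y_{ij}^\ell)_{i\in\mathcal N,j\in\mathcal M,\ell\in\mathcal L_+}\ge\boldsymbol 0$: $$\max\ \sum_{i\in\mathcal N}\sum_{j\in\mathcal M}\sum_{\ell\in\mathcal L_+}r_{ij}^\ell y_{ij}^\ell$$ subject to $\sum_{j\in\mathcal M}y_{ij}^\ell\le c_i^\ell$ for all $i\in\mathcal N,\ell\in\mathcal L$;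 $\sum_{i\in\mathcal N}\sum_{\ell\in\mathcal L_+}y_{ij}^\ell\le\tau_j/2$ for all $j\in\mathcal M$; $\sum_{\ell\in\mathcal L_+}y_{ij}^\ell\le v_{ij}\tau_j/2$ for all $i\in\mathcal N,j\in\mathcal M$. *)

(* Defs.v *)
From HB Require Import structures.
From mathcomp Require Import all_boot all_order all_algebra.
From mathcomp Require Import all_classical all_reals.

Set Implicit Arguments.
Unset Strict Implicit.
Unset Printing Implicit Defensive.

Import Order.TTheory GRing.Theory Num.Theory.

Local Open Scope classical_set_scope.
Local Open Scope ring_scope.

(* The layers L_+ = {1, ..., L, L+1} are 'I_L.+1: the index
   L+1 is ord_max, and l : 'I_L is embedded as lift ord_max l, which has the
   same value as l. *)

Section FApp.

Variables (R : realType) (n m L : nat).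

Definition reward_ext (r : 'I_n -> 'I_m -> 'I_L -> R)
    (i : 'I_n) (j : 'I_m) (l : 'I_L.+1) : R :=
  if unlift ord_max l is Some l' then r i j l' else 0.

Definition lp_objective (r : 'I_n -> 'I_m -> 'I_L -> R)
    (y : 'I_n -> 'I_m -> 'I_L.+1 -> R) : R :=
  \sum_(i < n) \sum_(j < m) \sum_(l < L.+1) reward_ext r i j l * y i j l.

Definition lp_feasible (tau : 'I_m -> R) (v : 'I_n -> 'I_m -> R)
    (c : 'M[nat]_(n, L)) (y : 'I_n -> 'I_m -> 'I_L.+1 -> R) : Prop :=
  [/\ forall i j l, 0 <= y i j l,
      forall (i : 'I_n) (l : 'I_L),
        \sum_(j < m) y i j (lift ord_max l) <= (c i l)%:R,
      forall j, \sum_(i < n) \sum_(l < L.+1) y i j l <= tau j / 2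
    & forall i j, \sum_(l < L.+1) y i j l <= v i j * tau j / 2].

Definition lp_values (r : 'I_n -> 'I_m -> 'I_L -> R) (tau : 'I_m -> R)
    (v : 'I_n -> 'I_m -> R) (c : 'M[nat]_(n, L)) : set R :=
  [set lp_objective r y | y in [set y | lp_feasible tau v c y]].

(* For tau, v >= 0 the set of values is nonempty and bounded (lp_values_has_sup),
   so that sup, which is 0 by convention otherwise, is the optimal value. *)
Definition f_app (r : 'I_n -> 'I_m -> 'I_L -> R) (tau : 'I_m -> R)
    (v : 'I_n -> 'I_m -> R) (c : 'M[nat]_(n, L)) : R :=
  sup (lp_values r tau v c).

(* Vectors of Z_+^(nL) are matrices 'M[nat]_(n, L), and the unit vector of
   coordinate (i, l) is delta_mx i l. *)
Definition DR_submodular (f : 'M[nat]_(n, L) -> R) : Prop :=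
  forall b c : 'M[nat]_(n, L), (forall i l, (b i l <= c i l)%N) ->
  forall (i : 'I_n) (l : 'I_L),
    f c + f (b + delta_mx i l) >= f (c + delta_mx i l) + f b.

Lemma lp_values_has_sup (r : 'I_n -> 'I_m -> 'I_L -> R) (tau : 'I_m -> R)
    (v : 'I_n -> 'I_m -> R) (c : 'M[nat]_(n, L)) :
  (forall j, 0 <= tau j) -> (forall i j, 0 <= v i j) ->
  has_sup (lp_values r tau v c).
Proof.
move=> tau0 v0; split.
  exists (lp_objective r (fun _ _ _ => 0)), (fun _ _ _ => 0) => //.
  split=> [//|i l|j|i j].
  - by rewrite big1.
  - rewrite big1 ?divr_ge0// => i _; by rewrite big1.
  - by rewrite big1// divr_ge0// mulr_ge0.
exists (\sum_(i < n) \sum_(j < m) \sum_(l < L.+1)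
          `|reward_ext r i j l| * (tau j / 2)).
move=> _ [y [y0 _ ytau _] <-].
apply: ler_sum => i _; apply: ler_sum => j _; apply: ler_sum => l _.
apply: (le_trans (ler_norm _)); rewrite normrM ler_wpM2l// ger0_norm//.
apply: le_trans (ytau j).
rewrite (bigD1 i)//= (bigD1 l)//= -addrA lerDl addr_ge0// sumr_ge0// => i' _.
by rewrite sumr_ge0.
Qed.

End FApp.

(* Main.v *)
(* Exchange argument. Let [y] be feasible for [c + e] and [x] for [b]. The
   difference [y - x] is a flow from the sources [(i, l)] through the nodes
   [(i, j)] to the sinks [j]. If [y] exceeds [c] at the source of [e], by
   [theta <= 1] say, that source has excess at least [theta] in [y - x], and
   routing [theta] units along paths of the support of [y - x] gives a conformal
   part [w] of [y - x] that ends only where the excess is negative. Then [y - w]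
   is feasible for [c], [x + w] is feasible for [b + e], and the total objective
   is unchanged. *)
Require Import Defs.
From HB Require Import structures.
From mathcomp Require Import all_boot all_order all_algebra.
From mathcomp Require Import all_classical all_reals.
From mathcomp Require Import ring lra.
Set Implicit Arguments.
Unset Strict Implicit.
Unset Printing Implicit Defensive.
Import Order.TTheory GRing.Theory Num.Theory.
Local Open Scope ring_scope.

(** * Flows on a finite directed graph and extraction of conformal subflows *)

Section Flow.
Variables (R : realFieldType) (V : finType).
Implicit Types (d w : V -> V -> R) (s t u v : V).

(** Sign convention: net outflow, so sources are positive and sinks negative. *)
Definition excess d u : R := \sum_v d u v - \sum_v d v u.

Lemma excessD d w u :
  excess (fun a b => d a b + w a b) u = excess d u + excess w u.
Proof. by rewrite /excess !big_split/=; ring. Qed.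

Lemma excessZ (k : R) d u :
  excess (fun a b => k * d a b) u = k * excess d u.
Proof. by rewrite /excess -!mulr_sumr mulrBr. Qed.

Fixpoint path_flow (x : V) (p : seq V) : V -> V -> R :=
  if p is y :: q then
    fun u v => ((u == x) && (v == y))%:R + path_flow y q u v
  else fun _ _ => 0.

Lemma excess_path_flow x p u :
  excess (path_flow x p) u = (u == x)%:R - (u == last x p)%:R.
Proof.
elim: p x => [|y q IH] x /=; first by rewrite /excess !big1// !subrr.
rewrite excessD IH /excess.
have -> : \sum_v ((u == x) && (v == y))%:R = (u == x)%:R :> R.
  rewrite (bigD1 y)//= eqxx andbT big1 ?addr0// => v /negbTE ->.
  by rewrite andbF.
have -> : \sum_v ((v == x) && (u == y))%:R = (u == y)%:R :> R.
  by rewrite (bigD1 x)//= eqxx big1 ?addr0// => v /negbTE ->.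
by ring.
Qed.

Lemma path_flow_notin x p u v : u \notin x :: p -> path_flow x p u v = 0.
Proof.
elim: p x => [|y q IH] x//=; rewrite inE negb_or => /andP[/negbTE-> uq].
by rewrite IH// addr0.
Qed.

Lemma path_flow01 x p u v :
  uniq (x :: p) -> path_flow x p u v = 0 \/ path_flow x p u v = 1.
Proof.
elim: p x => [|y q IH] x; first by left.
rewrite cons_uniq => /andP[xq /IH].
have [->|/negbTE ux] := eqVneq u x; last by rewrite /= ux add0r.
rewrite /= eqxx path_flow_notin// addr0 => _.
by case: (v == y); [right|left].
Qed.

Lemma path_flow_neq0 (e : rel V) x p u v :
  path e x p -> path_flow x p u v != 0 -> e u v.
Proof.
elim: p x => [|y q IH] x /=; first by rewrite eqxx.
move=> /andP[exy /IH {}IH].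
by have [/andP[/eqP-> /eqP->]//|_] := boolP (_ && _); rewrite add0r.
Qed.

(* The vertices reachable from [s] through the support of [d] have no outgoing
   flow, so their excesses sum to a nonpositive number. *)
Lemma positive_excess_path d s :
  (forall u v, 0 <= d u v) -> 0 < excess d s ->
  exists p, [/\ path [rel u v | 0 < d u v] s p, uniq (s :: p)
    & excess d (last s p) < 0].
Proof.
move=> d0 ds; set e := [rel u v | 0 < d u v].
suff [t st t0] : exists2 t, connect e s t & excess d t < 0.
  have [p ep tE] := connectP st; move: t0; rewrite tE.
  by case: (shortenP ep) => q eq uq _ t0; exists q.
apply: contrapT => H.
have : 0 < \sum_(t | connect e s t) excess d t.
  rewrite (bigD1 s) ?connect0//= ltr_pwDl// sumr_ge0// => t /andP[st _].
  by rewrite leNgt; apply/negP => ?; apply: H; exists t.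
apply/negP; rewrite -leNgt /excess sumrB subr_le0.
have -> : \sum_(t | connect e s t) \sum_v d t v =
    \sum_(t | connect e s t) \sum_(v | connect e s v) d t v.
  apply: eq_bigr => t st; rewrite [RHS]big_mkcond; apply: eq_bigr => v _.
  case: ifPn => // /negP sv; apply/eqP; rewrite eq_le d0 andbT leNgt.
  by apply/negP => tv; apply: sv; apply: connect_trans st (connect1 _).
rewrite exchange_big/= ler_sum// => t st.
rewrite [leLHS]big_mkcond ler_sum// => v _; by case: ifP.
Qed.

(** Augmenting paths: push as much as possible from [s] to a vertex of negative excess, subtract,
    and repeat with what remains of [theta]. Each round completes [theta], empties an arc or
    exhausts a deficit, so the number of support arcs plus the number of deficient vertices
    decreases. *)
Lemma conformal_subflow d s (theta : R) :
  (forall u v, 0 <= d u v) -> 0 <= theta -> theta <= excess d s ->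
  exists w, [/\ forall u v, 0 <= w u v <= d u v, excess w s = theta
    & forall u, u != s -> Num.min (excess d u) 0 <= excess w u <= 0].
Proof.
have [k] := ubnP (#|[pred a : V * V | d a.1 a.2 != 0%R]|
                  + #|[pred u | (excess d u < 0)%R]|).
elim: k d theta => // k IH d theta dk d0.
rewrite le_eqVlt => /predU1P[<- _|th0 ths].
  have ex0 u : excess (fun _ _ => 0) u = 0 by rewrite /excess !big1// subrr.
  exists (fun _ _ => 0).
  by split => [u v|//|u us]; rewrite ?ex0 ?lexx ?d0// ge_min lexx orbT.
have [p [ep up tneg]] := positive_excess_path d0 (lt_le_trans th0 ths).
set f := path_flow s p; set t := last s p in tneg.
have ts : t != s.
  by apply/eqP => tE; move: tneg; rewrite tE ltNge (ltW (lt_le_trans th0 ths)).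
have f01 u v : f u v = 0 \/ f u v = 1 by exact: path_flow01.
have fd u v : f u v != 0 -> 0 < d u v by exact: (path_flow_neq0 ep).
have fe u : excess f u = (u == s)%:R - (u == t)%:R by exact: excess_path_flow.
have [a0 fa0] : exists a : V * V, f a.1 a.2 != 0.
  have : p != [::] by apply: contraNneq ts => p0; rewrite /t p0.
  rewrite /f; case: (p) up => // y q; rewrite cons_uniq => /andP[sq _] _.
  by exists (s, y); rewrite /= !eqxx path_flow_notin// addr0 oner_eq0.
(* [a] is a bottleneck arc of the path, which has an arc because [t != s]. *)
case: (@arg_minP _ _ _ a0 (fun a => f a.1 a.2 != 0) (fun a => d a.1 a.2) fa0).
move=> a fa amin.
(* The amount pushed is limited by what remains to be routed, by the deficit of [t] and by the
   bottleneck. *)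
pose del := Num.min (Num.min theta (- excess d t)) (d a.1 a.2).
have del0 : 0 < del by rewrite !lt_min th0 oppr_gt0 tneg fd.
have delth : del <= theta by rewrite !ge_min lexx.
have delt : del <= - excess d t by rewrite !ge_min lexx orbT.
have dela : del <= d a.1 a.2 by rewrite !ge_min lexx orbT.
have delf u v : 0 <= del * f u v <= d u v.
  have [->|fn0] := eqVneq (f u v) 0; first by rewrite mulr0 lexx d0.
  have [fE|->] := f01 u v; first by rewrite fE eqxx in fn0.
  by rewrite mulr1 (ltW del0)/= (le_trans dela)// (amin (u, v)).
have fs : excess f s = 1 by rewrite fe eqxx eq_sym (negbTE ts) subr0.
have ft : excess f t = -1 by rewrite fe eqxx (negbTE ts) sub0r.
have fu u : u != s -> u != t -> excess f u = 0.
  by rewrite fe => /negbTE-> /negbTE->; rewrite subrr.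
have [delE|delN] := eqVneq del theta.
  exists (fun u v => del * f u v); split => // [|u us].
    by rewrite excessZ fs mulr1.
  rewrite excessZ; have [->|ut] := eqVneq u t.
    by rewrite ft mulrN1 oppr_le0 (ltW del0) ge_min lerNr delt.
  by rewrite fu// mulr0 lexx ge_min lexx orbT.
pose d' u v := d u v + (- del) * f u v.
have d'e u : excess d' u = excess d u - del * excess f u.
  by rewrite /d' excessD excessZ mulNr.
have d'0 u v : 0 <= d' u v.
  by rewrite /d' mulNr subr_ge0; case/andP: (delf u v).
have d's : theta - del <= excess d' s by rewrite d'e fs mulr1 lerB.
have sub1 : [pred a | d' a.1 a.2 != 0] \subset [pred a | d a.1 a.2 != 0].
  apply/fintype.subsetP => -[u v]; rewrite !inE/=; apply: contraNN => /eqP duv.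
  have [fE|fE] := eqVneq (f u v) 0; first by rewrite /d' duv fE mulr0 addr0.
  by have := fd u v fE; rewrite duv ltxx.
(* No new deficit appears: [s] keeps excess at least [theta - del >= 0], [t] was already deficient,
   and other excesses are unchanged. *)
have sub2 : [pred u | excess d' u < 0] \subset [pred u | excess d u < 0].
  apply/fintype.subsetP => u; rewrite !inE; have [->|us] := eqVneq u s.
    by rewrite ltNge (le_trans _ d's)// subr_ge0.
  have [->//|ut] := eqVneq u t; by rewrite d'e fu// mulr0 subr0.
have meas : (#|[pred a | d' a.1 a.2 != 0%R]|
              + #|[pred u | (excess d' u < 0)%R]| < k)%N.
  rewrite ltnS in dk; apply: leq_trans dk.
  (* Either the arc [a] leaves the support, or [del] is the whole deficit of [t] and [t] ceases to
     be deficient. *)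
  have [daE|daN] := eqVneq del (d a.1 a.2).
    rewrite -addSn leq_add ?subset_leq_card// proper_card// properE sub1/=.
    apply/fintype.subsetPn; exists a; first by rewrite !inE gt_eqF// fd.
    rewrite !inE negbK /d'.
    have [fE|->] := f01 a.1 a.2; first by rewrite fE eqxx in fa.
    by rewrite mulr1 -daE subrr.
  have dtE : del = - excess d t.
    move: delN daN; rewrite /del; case: (leP (Num.min _ _)); last by rewrite eqxx.
    by case: (leP theta); rewrite ?eqxx.
  rewrite -addnS leq_add ?subset_leq_card// proper_card// properE sub2/=.
  apply/fintype.subsetPn; exists t; rewrite !inE ?tneg// d'e ft dtE.
  by rewrite mulrN1 !opprK -leNgt subrr.
have [w [wd ws wu]] := IH d' (theta - del) meas d'0 (etrans (subr_ge0 _ _) delth) d's.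
exists (fun u v => w u v + del * f u v); split => [u v||u us].
- have /andP[w0 wd'] := wd u v; have /andP[f0 _] := delf u v.
  by rewrite addr_ge0//= -lerBrDr (le_trans wd')// /d' mulNr.
- by rewrite excessD excessZ ws fs mulr1 subrK.
- rewrite excessD excessZ; have := wu u us; rewrite d'e.
  have [->|ut] := eqVneq u t; last by rewrite fu// mulr0 subr0 addr0.
  (* The excess of [d'] at [t] is that of [d] plus [del], still nonpositive by [delt]; adding the
     path back shifts the bounds by [-del]. *)
  rewrite ft !ge_min => /andP[wt ?]; apply/andP; split; last by lra.
  by apply/orP; left; case/orP: wt => ?; lra.
Qed.

(** The previous lemma is applied to the positive part of [g], and the result is antisymmetrized. Of
    two opposite arcs at most one carries positive flow, so no cancellation spoils conformality. *)
Lemma conformal_net_subflow (g : V -> V -> R) s (theta : R) :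
  (forall u v, g u v = - g v u) -> 0 <= theta -> theta <= \sum_v g s v ->
  exists w, [/\ forall u v, w u v = - w v u,
    forall u v, Num.min (g u v) 0 <= w u v <= Num.max (g u v) 0,
    \sum_v w s v = theta
    & forall u, u != s -> Num.min (\sum_v g u v) 0 <= \sum_v w u v <= 0].
Proof.
move=> gN th0 ths; pose d u v := Num.max (g u v) 0.
have dg u : excess d u = \sum_v g u v.
  rewrite /excess -sumrB; apply: eq_bigr => v _; rewrite /d (gN v u).
  by case: (leP (g u v) 0); case: (leP (- g u v) 0) => ? ?; lra.
have d0 u v : 0 <= d u v by rewrite /d le_max lexx orbT.
have [w [wd ws wu]] := @conformal_subflow d s theta d0 th0 ltac:(by rewrite dg).
exists (fun u v => w u v - w v u); split => [u v|u v||u us].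
- by rewrite opprB.
- have := wd u v; have := wd v u; rewrite /d (gN v u) => /andP[? h1] /andP[? h2].
  apply/andP; split; move: h1 h2;
    by case: (leP (g u v) 0); case: (leP (- g u v) 0) => *; lra.
- by rewrite sumrB.
- by rewrite sumrB -dg; exact: wu.
Qed.

End Flow.

(** * The three-level network of a signed allocation *)

Section Layers.
Variables (R : realFieldType) (n m K : nat).
Implicit Types d : 'I_n -> 'I_m -> 'I_K -> R.

Let V : finType := (('I_n * 'I_K) + ('I_n * 'I_m) + 'I_m)%type.

(* Each unit of [d i j k] runs along [(i, k) -> (i, j) -> j]; all three families
   of sums in the linear program become excesses or arc flows. *)
Let layer_flow d (u v : V) : R :=
  match u, v with
  | inl (inl (i, k)), inl (inr (i', j)) => if i' == i then d i j k else 0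
  | inl (inr (i', j)), inl (inl (i, k)) => if i' == i then - d i j k else 0
  | inl (inr (i, j)), inr j' => if j' == j then \sum_k d i j k else 0
  | inr j', inl (inr (i, j)) => if j' == j then - \sum_k d i j k else 0
  | _, _ => 0
  end.

Let big_vertices (F : V -> R) : \sum_v F v =
  \sum_i \sum_k F (inl (inl (i, k))) + \sum_i \sum_j F (inl (inr (i, j)))
  + \sum_j F (inr j).
Proof.
rewrite big_sumType big_sumType !pair_bigA /=.
by do 2 congr (_ + _); apply: eq_bigr => -[].
Qed.

Let big_only (I : finType) (i0 : I) (F : I -> R) :
  (forall i, i != i0 -> F i = 0) -> \sum_i F i = F i0.
Proof. by move=> F0; rewrite (bigD1 i0)//= big1 ?addr0// => i /F0. Qed.

(** In the network of [d], arc conformality bounds the entries and the sums over [k], while the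
    excess bounds at sinks and sources control the sums over [(i, k)] and over [j]. *)
Lemma conformal_layers d i0 k0 (theta : R) :
  0 <= theta -> theta <= \sum_j d i0 j k0 ->
  exists w : 'I_n -> 'I_m -> 'I_K -> R,
  [/\ forall i j k, Num.min (d i j k) 0 <= w i j k <= Num.max (d i j k) 0,
      forall i j, Num.min (\sum_k d i j k) 0 <= \sum_k w i j k
                  <= Num.max (\sum_k d i j k) 0,
      forall j, Num.min (\sum_i \sum_k d i j k) 0 <= \sum_i \sum_k w i j k
                <= Num.max (\sum_i \sum_k d i j k) 0,
      \sum_j w i0 j k0 = theta
    & forall i k, (i, k) != (i0, k0) ->
        Num.min (\sum_j d i j k) 0 <= \sum_j w i j k <= 0].
Proof.
move=> th0 ths; set g := layer_flow d.
have gN u v : g u v = - g v u.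
  case: u => [[[i k]|[i j]]|j]; case: v => [[[i' k']|[i' j']]|j'] /=;
    rewrite ?oppr0//; by case: ifP; rewrite ?opprK ?oppr0.
have gsrc i k : \sum_v g (inl (inl (i, k))) v = \sum_j d i j k.
  rewrite big_vertices/= [X in _ + X]big1// [X in X + _ + _]big1 ?add0r ?addr0.
    rewrite (big_only (i0 := i)) => [|i' /negbTE ii']; last first.
      by rewrite big1// => j _; rewrite ii'.
    by apply: eq_bigr => j _; rewrite eqxx.
  by move=> i' _; rewrite big1.
have gmid i j : \sum_v g (inl (inr (i, j))) v = 0.
  rewrite big_vertices/= [X in _ + X + _]big1 => [|i' _]; last by rewrite big1.
  rewrite addr0 (big_only (i0 := i)) => [|i' ii']; last first.
    by rewrite big1// => k _; rewrite eq_sym (negbTE ii').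
  rewrite [X in _ + X](big_only (i0 := j)) => [|j' /negbTE->//].
  by rewrite !eqxx sumrN addNr.
have gsnk j : \sum_v g (inr j) v = - \sum_i \sum_k d i j k.
  rewrite big_vertices/= [X in _ + X]big1// [X in X + _ + _]big1 ?add0r ?addr0; last first.
    by move=> i' _; rewrite big1.
  rewrite -sumrN; apply: eq_bigr => i _.
  rewrite (big_only (i0 := j)) => [|j' /negbTE jj']; last by rewrite eq_sym jj'.
  by rewrite eqxx.
have [|w [wN wg ws wu]] := conformal_net_subflow (s := inl (inl (i0, k0))) gN th0.
  by rewrite gsrc.
(* Conformality confines [w] to the arcs of the network. *)
have w0 u v : g u v = 0 -> w u v = 0.
  by move=> guv; have := wg u v; rewrite guv minxx maxxx => /le_anti.
have wsrc i k : \sum_v w (inl (inl (i, k))) v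
    = \sum_j w (inl (inl (i, k))) (inl (inr (i, j))).
  rewrite big_vertices [X in _ + X]big1 => [|j _]; last exact: w0.
  rewrite [X in X + _ + _]big1 => [|i' _]; last first.
    by rewrite big1// => j _; exact: w0.
  rewrite add0r addr0 (big_only (i0 := i))// => i' /negbTE ii'.
  by rewrite big1// => j _; apply: w0; rewrite /= ii'.
(* A middle node has excess zero in [g], so its excess in [w] is squeezed to zero: inflow equals
   outflow. *)
have wmid i j : w (inl (inr (i, j))) (inr j)
    = \sum_k w (inl (inl (i, k))) (inl (inr (i, j))).
  have := wu (inl (inr (i, j))) isT; rewrite gmid minxx => /le_anti.
  rewrite big_vertices [X in _ + X + _]big1 => [|i' _]; last first.
    by rewrite big1// => k _; exact: w0.
  rewrite addr0 (big_only (i0 := i)) => [|i' ii']; last first.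
    by rewrite big1// => k _; apply: w0; rewrite /= eq_sym (negbTE ii').
  rewrite [X in _ + X](big_only (i0 := j)) => [|j' /negbTE jj']; last first.
    by apply: w0; rewrite /= jj'.
  move=> /esym/eqP; rewrite addrC addr_eq0 => /eqP ->; rewrite -sumrN.
  by apply: eq_bigr => k _; rewrite -wN.
have wsnk j : \sum_v w (inr j) v
    = - \sum_i \sum_k w (inl (inl (i, k))) (inl (inr (i, j))).
  rewrite big_vertices [X in _ + X]big1 => [|j' _]; last exact: w0.
  rewrite [X in X + _ + _]big1 => [|i' _]; last first.
    by rewrite big1// => k _; exact: w0.
  rewrite add0r addr0 -sumrN; apply: eq_bigr => i _.
  rewrite (big_only (i0 := j)) => [|j' /negbTE jj']; last first.
    by apply: w0; rewrite /= eq_sym jj'.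
  by rewrite wN wmid.
exists (fun i j k => w (inl (inl (i, k))) (inl (inr (i, j)))); split.
- move=> i j k; have := wg (inl (inl (i, k))) (inl (inr (i, j))).
  by rewrite /= eqxx.
- move=> i j; have := wg (inl (inr (i, j))) (inr j).
  by rewrite /= eqxx wmid.
- move=> j; have := wu (inr j) isT; rewrite gsnk wsnk le_max !ge_min.
  move=> /andP[h1 h2]; apply/andP; split; first by apply/orP; right; lra.
  by apply/orP; case/orP: h1 => ?; [left|right]; lra.
- by rewrite -wsrc.
- by move=> i k ik; rewrite -wsrc -gsrc; apply: wu.
Qed.

End Layers.

(** Both [y - w] and [x + w] lie between [x] and [y], so they inherit every bound common to the
    two. *)
Lemma shift_between (R : realFieldType) (x y w : R) :
  Num.min (y - x) 0 <= w <= Num.max (y - x) 0 ->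
  forall t, (x <= t -> y <= t -> y - w <= t /\ x + w <= t) /\
            (t <= x -> t <= y -> t <= y - w /\ t <= x + w).
Proof. by case: (leP (y - x) 0) => h /andP[? ?] t; split => ? ?; split; lra. Qed.

(** * Exchange between feasible solutions of the linear program *)

Section Exchange.
Variables (R : realType) (n m L : nat).
Variables (tau : 'I_m -> R) (v : 'I_n -> 'I_m -> R).
Implicit Types (b c : 'M[nat]_(n, L)) (x y : 'I_n -> 'I_m -> 'I_L.+1 -> R).

Lemma natr_add_delta c i l i' l' :
  ((c + delta_mx i l)%R i' l')%:R
  = (c i' l')%:R + ((i' == i) && (l' == l))%:R :> R.
Proof. by rewrite !mxE natrD natn. Qed.

Lemma lp_feasible_exchange b c i l x y :
  (forall i l, (b i l <= c i l)%N) ->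
  lp_feasible tau v (c + delta_mx i l) y -> lp_feasible tau v b x ->
  exists w, lp_feasible tau v c (fun i j k => y i j k - w i j k) /\
            lp_feasible tau v (b + delta_mx i l)
              (fun i j k => x i j k + w i j k).
Proof.
move=> bc [y0 yc ytau yv] [x0 xb xtau xv].
have bcR i' l' : (b i' l')%:R <= (c i' l')%:R :> R by rewrite ler_nat.
pose theta := \sum_j y i j (lift ord_max l) - (c i l)%:R.
have := yc i l; rewrite natr_add_delta !eqxx => yil.
have yc' i' l' : (i', l') != (i, l) ->
    \sum_j y i' j (lift ord_max l') <= (c i' l')%:R.
  move=> il'; have := yc i' l'; rewrite natr_add_delta.
  by move: il'; rewrite xpair_eqE => /negbTE->; rewrite addr0.
(* Without overuse of [c] at [(i, l)], [y] is already feasible for [c] and nothing is moved. *)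
have [th0|th0] := leP theta 0.
  exists (fun _ _ _ => 0); split; split=> [i' j k|i' l'|j|i' j].
  - by rewrite subr0.
  - under eq_bigr do rewrite subr0.
    have [[-> ->]|/yc'//] := eqVneq (i', l') (i, l).
    by rewrite -subr_le0.
  - by under eq_bigr do under eq_bigr do rewrite subr0.
  - by under eq_bigr do rewrite subr0.
  - by rewrite addr0.
  - under eq_bigr do rewrite addr0.
    by rewrite natr_add_delta (le_trans (xb _ _))// lerDl.
  - by under eq_bigr do under eq_bigr do rewrite addr0.
  - by under eq_bigr do rewrite addr0.
have [|w [wd wm wt ws wu]] :=
    conformal_layers (d := fun i j k => y i j k - x i j k)
      (i0 := i) (k0 := lift ord_max l) (ltW th0).
  (* The source has excess at least [theta] because [x] uses at most [b i l <= c i l] there. *)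
  by rewrite sumrB lerB// (le_trans (xb _ _)).
have {}wm i' j : Num.min (\sum_k y i' j k - \sum_k x i' j k) 0
    <= \sum_k w i' j k <= Num.max (\sum_k y i' j k - \sum_k x i' j k) 0.
  by rewrite -sumrB; exact: wm.
have {}wt j : Num.min (\sum_i \sum_k y i j k - \sum_i \sum_k x i j k) 0
    <= \sum_i \sum_k w i j k
    <= Num.max (\sum_i \sum_k y i j k - \sum_i \sum_k x i j k) 0.
  by rewrite -sumrB; under eq_bigr do rewrite -sumrB; exact: wt.
(* Only sources of layers in ['I_L] have a capacity, so the bound is kept for lifted indices
   alone. *)
have {}wu i' l' : (i', l') != (i, l) ->
    Num.min (\sum_j y i' j (lift ord_max l') - \sum_j x i' j (lift ord_max l')) 0
    <= \sum_j w i' j (lift ord_max l') <= 0.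
  move=> il'; rewrite -sumrB; apply: wu; move: il'; rewrite !xpair_eqE.
  by rewrite (inj_eq lift_inj).
exists w; split; split=> [i' j k|i' l'|j|i' j].
- by have [_ /(_ (x0 _ _ _) (y0 _ _ _))[]] := shift_between (wd i' j k) 0.
(* At [(i, l)] the use drops to exactly [c i l]; elsewhere it is at most the larger of the uses by
   [y] and [x], and [b <= c] bounds the latter. *)
- rewrite sumrB; have [[-> ->]|il'] := eqVneq (i', l') (i, l).
    by rewrite ws /theta; lra.
  have := wu _ _ il'; have := yc' _ _ il'; have := xb i' l'; have := bcR i' l'.
  by rewrite ge_min => ? ? ? /andP[/orP[?|?] ?]; lra.
- under eq_bigr do rewrite sumrB; rewrite sumrB.
  by have [/(_ (xtau _) (ytau _))[]] := shift_between (wt j) (tau j / 2).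
- rewrite sumrB.
  by have [/(_ (xv _ _) (yv _ _))[]] := shift_between (wm i' j) (v i' j * tau j / 2).
- by have [_ /(_ (x0 _ _ _) (y0 _ _ _))[]] := shift_between (wd i' j k) 0.
(* At [(i, l)] the use grows by [theta <= 1], which the unit vector absorbs; elsewhere it does not
   grow. *)
- rewrite big_split natr_add_delta -xpair_eqE /=.
  have := xb i' l'; have [[-> ->]|il'] := eqVneq (i', l') (i, l).
    by have := bcR i l; rewrite ws /theta; move: yil => /=; lra.
  by have /andP[_] := wu _ _ il'; rewrite addr0 => ? ?; lra.
- under eq_bigr do rewrite big_split; rewrite big_split /=.
  by have [/(_ (xtau _) (ytau _))[]] := shift_between (wt j) (tau j / 2).
- rewrite big_split /=.
  by have [/(_ (xv _ _) (yv _ _))[]] := shift_between (wm i' j) (v i' j * tau j / 2).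
Qed.

Lemma lp_objective_exchange (r : 'I_n -> 'I_m -> 'I_L -> R) x y w :
  lp_objective r (fun i j k => y i j k - w i j k)
    + lp_objective r (fun i j k => x i j k + w i j k)
  = lp_objective r y + lp_objective r x.
Proof.
rewrite /lp_objective -!big_split; apply: eq_bigr => i _ /=.
rewrite -!big_split; apply: eq_bigr => j _ /=.
by rewrite -!big_split; apply: eq_bigr => k _ /=; ring.
Qed.

End Exchange.

Theorem lemma5p4 (R : realType) (n m L : nat)
    (r : 'I_n -> 'I_m -> 'I_L -> R) (tau : 'I_m -> R)
    (v : 'I_n -> 'I_m -> R)
    (tau_ge0 : forall j, 0 <= tau j) (v_ge0 : forall i j, 0 <= v i j) :
  DR_submodular (f_app r tau v).
Proof.
move=> b c bc i l.
have has_sup_lp c' := lp_values_has_sup r c' tau_ge0 v_ge0.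
have le_f c' y : lp_feasible tau v c' y -> lp_objective r y <= f_app r tau v c'.
  by move=> cy; apply: ub_le_sup; [case: (has_sup_lp c')|exists y].
(* The two suprema on the smaller side are replaced in turn by the values of arbitrary feasible [y]
   and [x], to which the exchange applies. *)
rewrite -lerBrDr; apply: ge_sup; first by case: (has_sup_lp (c + delta_mx i l)).
move=> _ [y cy <-]; rewrite lerBrDl -lerBrDr.
apply: ge_sup; first by case: (has_sup_lp b).
move=> _ [x bx <-]; rewrite lerBrDr addrC.
have [w [cw bw]] := lp_feasible_exchange bc cy bx.
by rewrite -(lp_objective_exchange r x y w) lerD// le_f.
Qed.
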